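(* Let $N\in\mathbb N$ and set $n=2^N$. Define $\tilde q$ as the law of the matching $M$ in $[n]$ sampled as follows. 1. Sample $K\sim\mathrm{Unif}(\{1,\dots,\lg n\})$ and, conditionally on $K$, sample $D\sim\mathrm{Unif}\bigl((n/2^{K+1},\,n/2^K]\bigr)$. 2. Define $M_0=\bigcup_{\ell=0}^{2^{K-1}-1}\bigl(\ell n/2^{K-1}+E_{D,K}\bigr)$ and $M_r=r n/2^{K+1}+M_0$ for $r\in\{1,2,3\}$. 3. Sample $R\sim\mathrm{Unif}(\{0,1,2,3\})$ and set $M=M_R$. Then $|M|=\tfrac14 n$ deterministically. The parallel randomised sorter associated to $\tilde q$ requires order $(\log n)^2$ rounds to sort a length-$n$ list in the worst case, both in expectation and with polynomially small failure probability.
   Context: Write $[n]=\{0,1,\dots,n-1\}$ for the set of positions and $\lg n=\log_2 n$; $\log$ is the natural logarithm. Addition, differences and distances of positions are calculated modulo $n$. $\mathrm{Unif}$ of a set denotes the uniform distribution on it; for the interval $(n/2^{K+1},n/2^K]$ it is the uniform distribution on the integers in that interval. The draw of $R$ is independent of $(K,D)$. For $d,k\in\mathbb N$, $E_{d,k}$ is the collection of the pairs $\{i,i+d\}$ with $i$ running from $0$ to $n/2^{k+1}-1$. For a real number $a$ and a collection $S$ of pairs, $a+S=\{\{a+i,a+j\}:\{i,j\}\in S\}$. A matching in $[n]$ is a collection of disjoint pairs in $[n]$; $|M|$ is the number of pairs in $M$. A list of length $n$ is a sequence indexed by $[n]$ with values (labels) in a totally ordered set; it is sorted if its entries are in ascending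 order. To sort a pair of positions $\{i,j\}$ with $i<j$ means: swap the entries at positions $i$ and $j$ if the entry in position $i$ is larger than that in position $j$, and otherwise do nothing. Given a probability measure $\tilde q$ on the set of matchings in $[n]$, a step (round) of the associated parallel randomised sorter chooses a matching $M\sim\tilde q$, independently of the past, and sorts the entries at the endpoints of each pair in $M$. ''Order $f(n)$'' means $\Theta(f(n))$, i.e. bounded above and below by positive constant multiples of $f(n)$. ''Worst case'' refers to the initial list. ''Both in expectation and with polynomially small failure probability'' means that the bound on the number of rounds holds in expectation and also with failure probability polynomially small in the length $n$.
   Formalization: For K = lg n, where n/2^{K+1} = 1/2 would make M empty, step 2 uses the blocks and shifts of level lg n − 1 with D = 1, so M_r = {{4l+r, 4l+r+1} : l < n/4}; and N ≥ 2 is assumed, since |M| = n/4 is impossible for N = 1 and K does not exist for N = 0. *)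

(* Defs.v *)
From HB Require Import structures.
From mathcomp Require Import all_boot all_order all_algebra.
From mathcomp Require Import all_classical all_reals all_analysis.
Set Implicit Arguments.
Unset Strict Implicit.
Unset Printing Implicit Defensive.
Import Order.TTheory GRing.Theory Num.Theory.
Local Open Scope ring_scope.

Section Matchings.
Local Open Scope nat_scope.
Local Open Scope set_scope.

(* Pairs of positions are two-element sets, so a collection of pairs in [n]   *)
(* is a term of type {set {set 'I_n}}.                                        *)
Definition is_matching n (M : {set {set 'I_n}}) : bool :=
  [forall e in M, #|e| == 2] && finset.trivIset M.

Lemma pow2_gt0 N : 0 < 2 ^ N. Proof. by rewrite expn_gt0. Qed.

Definition pos N (a : nat) : 'I_(2 ^ N) := Ordinal (ltn_pmod a (pow2_gt0 N)).

Definition base_pairs N (d k : nat) : {set {set 'I_(2 ^ N)}} :=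
  [set [set pos N i; pos N (i + d)] | i : 'I_(2 ^ N %/ 2 ^ k.+1)].

Definition shift N (a : nat) (S : {set {set 'I_(2 ^ N)}}) :
    {set {set 'I_(2 ^ N)}} :=
  [set [set pos N (a + i) | i : 'I_(2 ^ N) in e] | e : {set 'I_(2 ^ N)} in S].

(* M_r; the divisions are exact when 1 <= k < N.                              *)
Definition shifted_matching N (k d r : nat) : {set {set 'I_(2 ^ N)}} :=
  shift (r * (2 ^ N %/ 2 ^ k.+1))
    (\bigcup_(l < 2 ^ k.-1) shift (l * (2 ^ N %/ 2 ^ k.-1)) (base_pairs N d k)).

(* For k = N (hence d = 1) the quantity n / 2^(k+1) = 1/2 is not an integer:  *)
(* read literally, the range of i is empty and the shifts leave [n], so no    *)
(* adjacent entries would ever be compared and the matching would be empty    *)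
(* rather than of size n/4.  In this case only, the block structure is that   *)
(* of level N - 1, i.e. the pairs are {4l + r, 4l + r + 1}, l < n/4, while    *)
(* d = 1 is kept.                                                             *)
Definition sampled_matching N (k d r : nat) : {set {set 'I_(2 ^ N)}} :=
  shifted_matching N (minn k N.-1) d r.

(* The integers d with n / 2^(k+1) < d <= n / 2^k, where n = 2^N.             *)
Definition dist_range N (k : nat) : {set 'I_(2 ^ N).+1} :=
  [set d : 'I_(2 ^ N).+1 | (2 ^ N < d * 2 ^ k.+1) && (d * 2 ^ k <= 2 ^ N)].

End Matchings.

(* Probability mass function of the sampled matching.                         *)
Definition matching_law (R : realType) N (M : {set {set 'I_(2 ^ N)}}) : R :=
  \sum_(1 <= k < N.+1) N%:R^-1 *
    \sum_(d in dist_range N k) #|dist_range N k|%:R^-1 *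
      \sum_(r < 4) 4%:R^-1 * (M == sampled_matching N k d r)%:R.

Section Sorter.
Context {disp : Order.disp_t} {T : orderType disp} {n : nat}.
Implicit Types (x : {ffun 'I_n -> T}) (M : {set {set 'I_n}}).

Definition list_sorted x : bool :=
  [forall i : 'I_n, forall j : 'I_n, (i <= j)%N ==> (x i <= x j)%O].

Definition out_of_order x (i j : 'I_n) : bool :=
  ((i < j)%N && (x j < x i)%O) || ((j < i)%N && (x i < x j)%O).

(* When M is a matching, at most one pair of M contains p, so the pick is     *)
(* unambiguous.                                                               *)
Definition sort_matching M x : {ffun 'I_n -> T} :=
  [ffun p => if [pick q | ([set p; q]%SET \in M) && out_of_order x p q]
             is Some q then x q else x p].

Fixpoint sorter_run (M : nat -> {set {set 'I_n}}) x (t : nat) :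
    {ffun 'I_n -> T} :=
  if t is t'.+1 then sort_matching (M t') (sorter_run M x t') else x.

(* Number of rounds needed to sort x; it is +oo if x never gets sorted.       *)
Definition sorting_time (R : realType) (M : nat -> {set {set 'I_n}}) x :
    \bar R :=
  ereal_inf [set t%:R%:E | t in [set t : nat | list_sorted (sorter_run M x t)]]%classic.

End Sorter.

(* M 0, M 1, ... are independent random matchings with mass function q,       *)
(* expressed through the finite-dimensional distributions.                    *)
Definition iid_law (R : realType) (d : measure_display) (Om : measurableType d)
    (P : probability Om R) n (q : {set {set 'I_n}} -> R)
    (M : nat -> Om -> {set {set 'I_n}}) : Prop :=
  (forall t m, measurable [set w | M t w = m]%classic) /\
  (forall t (m : 'I_t -> {set {set 'I_n}}),
     P [set w | forall i : 'I_t, M i w = m i]%classic = (\prod_i q (m i))%:E).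

(* Main.v *)
(* A pair of positions i < j is compared in a round with probability at least
   1/(4N(j-i)): the law of the distance is harmonic.  For a 0-1 list, the number
   of inversions is a constant minus the sum of the positions of the ones, and
   sorting an inverted pair (i, j) increases this sum by j - i.  Hence, in mean,
   a round multiplies the number of inversions by at most 1 - 1/(4N).  Summing
   over the 0-1 lists obtained by thresholding at each entry gives a potential
   of an arbitrary list which is at most n^3 and at least 1 unless the list is
   sorted, so the list is unsorted after t rounds with probability at most
   n^3 (1 - 1/(4N))^t.

   For the lower bound, start from a single 1 at position n/2.  From there only
   pairs i < j compared with probability at most 4/(N(j-i)) matter, and then the
   mean of (n - position)^(-1/2) grows by a factor at most 1 + 8/N per round.
   It starts at (n/2)^(-1/2) and is 1 for the sorted list. *)
Require Import Defs.
From mathcomp Require Import all_boot all_order all_algebra.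
From mathcomp Require Import all_classical all_reals all_analysis.
From mathcomp Require Import measurable_realfun zify ring lra.
Set Implicit Arguments.
Unset Strict Implicit.
Unset Printing Implicit Defensive.
Import Order.TTheory GRing.Theory Num.Theory.
Local Open Scope ring_scope.

(** * The sampled matchings *)

Section Combinatorics.
Local Open Scope nat_scope.
Local Open Scope set_scope.

Definition edge N (d u : nat) : {set 'I_(2 ^ N)} := [set pos N u; pos N (u + d)].

Lemma pos_addr N a b : pos N (a + pos N b) = pos N (a + b).
Proof. by apply: val_inj; rewrite /= modnDmr. Qed.

Lemma pos_ord N (i : 'I_(2 ^ N)) : pos N i = i.
Proof. by apply: val_inj; rewrite /= modn_small. Qed.

Lemma shift_edge N a d u :
  [set pos N (a + i) | i : 'I_(2 ^ N) in edge N d u] = edge N d (a + u).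
Proof. by rewrite /edge imsetU1 imset_set1 !pos_addr addnA. Qed.

Lemma shifted_matchingP N k d r (e : {set 'I_(2 ^ N)}) :
  let L := 2 ^ N %/ 2 ^ k.+1 in
  reflect (exists l i, [/\ l < 2 ^ k.-1, i < L &
             e = edge N d (r * L + (l * (2 ^ N %/ 2 ^ k.-1) + i))])
          (e \in shifted_matching N k d r).
Proof.
move=> L; apply: (iffP imsetP) => [[e1 /bigcupP[l _ /imsetP[e2 /imsetP[i _ ->] ->]]] ->|].
  exists l, i; split => //.
  by rewrite -!/(edge _ _ _) !shift_edge.
move=> [l [i [lk iL ->]]].
exists (edge N d (l * (2 ^ N %/ 2 ^ k.-1) + i)); last by rewrite shift_edge.
apply/bigcupP; exists (Ordinal lk) => //.
apply/imsetP; exists (edge N d i); last by rewrite shift_edge.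
by apply/imsetP; exists (Ordinal iL).
Qed.

Lemma dist_rangeP N k (d : 'I_(2 ^ N).+1) : k <= N ->
  (d \in dist_range N k) = (2 ^ (N - k) < d.*2) && (d <= 2 ^ (N - k)).
Proof.
move=> kN; rewrite inE; move: (nat_of_ord d) => {}d.
have -> : 2 ^ N = 2 ^ (N - k) * 2 ^ k by rewrite -expnD subnK.
rewrite expnS mulnA ltn_pmul2r ?expn_gt0// leq_pmul2r ?expn_gt0//.
by rewrite muln2.
Qed.

(** The level [k'] cuts [n] into blocks of length [4 * L], and M_r starts its pairs in quarter r of
    each block. The bound [L <= d], rather than [L < d], covers k = N, where L = d = 1. *)
Lemma block_dims N k : 1 < N -> 0 < k <= N ->
  let k' := minn k N.-1 in let L := 2 ^ N %/ 2 ^ k'.+1 in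
  [/\ 2 ^ N %/ 2 ^ k'.-1 = 4 * L, 2 ^ k'.-1 * (4 * L) = 2 ^ N
    & forall d : 'I_(2 ^ N).+1, d \in dist_range N k -> [&& 0 < L, L <= d & d <= L.*2]].
Proof.
move=> N1 /andP[k0 kN] k' L.
have k'0 : 0 < k' by rewrite /k'; lia.
have k'N : k' < N by rewrite /k'; lia.
have LE : L = 2 ^ (N - k'.+1) by rewrite /L -expnB//.
have E4 : 2 ^ (N - k'.-1) = 4 * L.
  by rewrite LE -[4]/(2 ^ 2) -expnD; congr (2 ^ _); lia.
split.
- by rewrite -E4 expnB//; lia.
- by rewrite -E4 -expnD; congr (2 ^ _); lia.
move=> d; rewrite dist_rangeP// LE expn_gt0 /=.
case: (ltnP k N) => [kN1|Nk].
  have -> : k' = k by rewrite /k'; lia.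
  have -> : N - k = (N - k.+1).+1 by lia.
  by rewrite expnS; lia.
have -> : N - k = 0 by lia.
have -> : N - k'.+1 = 0 by rewrite /k'; lia.
by rewrite expn0; lia.
Qed.

Lemma divmod_uniq b l l' s s' : s < b -> s' < b -> l * b + s = l' * b + s' ->
  l = l' /\ s = s'.
Proof.
move=> sb s'b e; have b0 : 0 < b by lia.
have := congr1 (divn^~ b) e; have := congr1 (modn^~ b) e.
by rewrite /= !divnMDl// !modnMDl !modn_small// !divn_small// !addn0.
Qed.

Lemma pos_inj N a v v' : v < 2 ^ N -> v' < 2 ^ N ->
  pos N (a + v) = pos N (a + v') -> v = v'.
Proof.
move=> vn v'n /(congr1 val)/= /eqP; rewrite eqn_modDl !modn_small//.
by move/eqP.
Qed.

(** Relative to the shift [a], a pair starts in the first quarter of its block and ends in the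
    second or third, because L <= d <= 2L. So a common endpoint has the same role in both pairs, and
    Euclidean division by [b] recovers l and i. *)
Lemma edge_disjoint N d L B b a l i l' i' : 0 < L <= d -> d <= L.*2 -> b = 4 * L ->
  B * b = 2 ^ N -> l < B -> l' < B -> i < L -> i' < L ->
  ~~ [disjoint edge N d (a + (l * b + i)) & edge N d (a + (l' * b + i'))] ->
  l = l' /\ i = i'.
Proof.
move=> /andP[L0 Ld] d2 bE BE lB l'B iL i'L.
have lt m s : m < B -> s < b -> m * b + s < 2 ^ N.
  move=> mB sb; rewrite -BE; apply: (@leq_trans (m.+1 * b)); first by rewrite mulSn; lia.
  by rewrite leq_mul2r mB orbT.
have [ib i'b] : i < b /\ i' < b by lia.
have [idb i'db] : i + d < b /\ i' + d < b by lia.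
have uniq s s' : s < b -> s' < b ->
    pos N (a + (l * b + s)) = pos N (a + (l' * b + s')) -> l = l' /\ s = s'.
  by move=> sb s'b /(pos_inj (lt _ _ lB sb) (lt _ _ l'B s'b)); exact: divmod_uniq.
rewrite disjoint_subset => /subsetPn[z]; rewrite !inE negbK -!addnA.
by move=> /orP[]/eqP-> /orP[]/eqP /uniq[]//; lia.
Qed.

Lemma edge_card2 N d u : 0 < d < 2 ^ N -> #|edge N d u| = 2.
Proof.
move=> dn; rewrite cards2; case: eqVneq => // E.
have := @pos_inj N u 0 d; rewrite addn0 => /(_ _ _ E); lia.
Qed.

Lemma sampled_matching_spec N k r d : 1 < N -> 0 < k <= N -> d \in dist_range N k ->
  is_matching (sampled_matching N k d r) /\
  4 * #|sampled_matching N k d r| = 2 ^ N.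
Proof.
move=> N1 kN dk; have [E4 EB /(_ d dk)] := block_dims N1 kN.
rewrite /sampled_matching; set k' := minn _ _; set L := 2 ^ N %/ 2 ^ k'.+1.
move=> /and3P[Lgt0 Ld d2L].
pose f (p : 'I_(2 ^ k'.-1) * 'I_L) := edge N d (r * L + (p.1 * (4 * L) + p.2)).
have fP p p' : ~~ [disjoint f p & f p'] -> p = p'.
  case: p p' => [l i] [l' i'] /edge_disjoint H.
  have [] := H _ _ _ d2L erefl EB; rewrite ?Lgt0 ?ltn_ord//.
  by move=> /val_inj /= -> /val_inj /= ->.
have fc p : #|f p| = 2.
  rewrite edge_card2//.
  have : 4 * L <= 2 ^ N by rewrite -EB leq_pmull// expn_gt0.
  by lia.
have ME : shifted_matching N k' d r = [set f p | p in [set: 'I_(2 ^ k'.-1) * 'I_L]].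
  apply/setP => e; apply/shifted_matchingP/imsetP.
    by move=> [l [i [lk iL ->]]]; exists (Ordinal lk, Ordinal iL); rewrite // E4.
  by move=> [[l i] _ ->]; exists l, i; rewrite E4.
rewrite ME; split.
  apply/andP; split.
    by apply/forall_inP => e /imsetP[p _ ->]; rewrite fc.
  apply/finset.trivIsetP => e e' /imsetP[p _ ->] /imsetP[p' _ ->]; apply: contraNT.
  by move/fP->.
rewrite card_imset ?cardsT ?card_prod ?card_ord; first by rewrite mulnCA -EB.
move=> p p' e; apply: fP; by rewrite e -finset.setI_eq0 finset.setIid -card_gt0 fc.
Qed.

(** Position u lies in exactly one quarter of its block, and the index of this quarter is the r that
    makes u the start of a pair. *)
Lemma sampled_matching_cover N k d (u : 'I_(2 ^ N)) : 1 < N -> 0 < k <= N ->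
  d \in dist_range N k ->
  exists r : 'I_4, [set u; pos N (u + d)] \in sampled_matching N k d r.
Proof.
move=> N1 kN dk; have [E4 EB /(_ d dk)] := block_dims N1 kN.
rewrite /sampled_matching; set k' := minn _ _; set L := 2 ^ N %/ 2 ^ k'.+1.
move=> /and3P[Lgt0 Ld d2L].
have r4 : (u %/ L) %% 4 < 4 by rewrite ltn_mod.
exists (Ordinal r4); apply/shifted_matchingP.
exists (u %/ L %/ 4), (u %% L); split.
- by rewrite -divnMA (mulnC L) ltn_divLR ?EB ?ltn_ord//; lia.
- by rewrite ltn_mod.
rewrite E4 -/L /edge /=.
have -> : (u %/ L) %% 4 * L + (u %/ L %/ 4 * (4 * L) + u %% L) = u.
  rewrite [RHS](divn_eq u L) {3}(divn_eq (u %/ L) 4); lia.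
by rewrite pos_ord.
Qed.

Lemma sampled_matching_dist N k d r (i j : 'I_(2 ^ N)) :
  i < j -> d <= 2 ^ N -> [set i; j] \in sampled_matching N k d r ->
  (d == j - i) || (d == 2 ^ N - (j - i)).
Proof.
move=> ij dn /shifted_matchingP[l [i0 [_ _]]]; move: (_ + _) => u e.
have : i \in edge N d u /\ j \in edge N d u by rewrite -e !inE !eqxx orbT.
have ub : u %% 2 ^ N < 2 ^ N by rewrite ltn_mod pow2_gt0.
(* Since d <= n, the addition wraps around at most once; this gives the two cyclic distances. *)
have vE : (u + d) %% 2 ^ N = u %% 2 ^ N + d \/
          (u + d) %% 2 ^ N + 2 ^ N = u %% 2 ^ N + d.
  rewrite -modnDml; have := divn_eq (u %% 2 ^ N + d) (2 ^ N).
  have : (u %% 2 ^ N + d) %/ 2 ^ N < 2 by rewrite ltn_divLR ?pow2_gt0//; lia.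
  by case: (_ %/ _) => [|[|]]//=; lia.
rewrite !inE => -[/orP[]/eqP/(congr1 val)/= iE /orP[]/eqP/(congr1 val)/= jE].
all: by move: ub vE; rewrite -?iE -?jE; lia.
Qed.

End Combinatorics.

(** * Sorting along a matching *)

Section Sorting.
Context {n : nat}.
Implicit Types (M : {set {set 'I_n}}).

Lemma matching_uniq M (p q q' : 'I_n) : is_matching M ->
  [set p; q]%SET \in M -> [set p; q']%SET \in M -> q = q'.
Proof.
move=> /andP[/forall_inP M2 /finset.trivIsetP tM] pq pq'.
have /eqP E : [set p; q]%SET == [set p; q']%SET.
  apply: contraT => /(tM _ _ pq pq'); rewrite disjoint_subset => /fintype.subsetP/(_ p).
  by rewrite !inE eqxx => /(_ isT).
have := set22 p q; rewrite E !inE => /orP[]/eqP // qp.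
by have := M2 _ pq; rewrite qp finset.setUid cards1.
Qed.

Section Partner.
Context {disp : Order.disp_t} {T : orderType disp}.
Implicit Types (x : {ffun 'I_n -> T}).

Lemma out_of_orderC x i j : out_of_order x i j = out_of_order x j i.
Proof. by rewrite /out_of_order orbC. Qed.

Definition partner M x (p : 'I_n) : 'I_n :=
  if [pick q | ([set p; q]%SET \in M) && out_of_order x p q] is Some q
  then q else p.

Lemma sort_matchingE M x p : sort_matching M x p = x (partner M x p).
Proof. by rewrite /partner ffunE; case: pickP. Qed.

Lemma partner_eq M x p q : is_matching M ->
  [set p; q]%SET \in M -> out_of_order x p q -> partner M x p = q.
Proof.
move=> mM pq oq; rewrite /partner; case: pickP => [q' /andP[pq' _]|/(_ q)].
  exact: matching_uniq mM pq' pq.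
by rewrite pq oq.
Qed.

(** This makes one round a permutation of the entries, so that sums over positions can be reindexed
    to follow each entry. *)
Lemma partnerK M x : is_matching M -> involutive (partner M x).
Proof.
move=> mM p; rewrite {2}/partner; case: pickP => [q /andP[pq o]|E].
  by apply: partner_eq => //; rewrite 1?out_of_orderC// finset.setUC.
by rewrite /partner; case: pickP => // q; rewrite E.
Qed.

Lemma sort_sorted M x : list_sorted x -> sort_matching M x = x.
Proof.
move=> /forallP sx; apply/ffunP => p; rewrite ffunE; case: pickP => // q /andP[_].
have le (i j : 'I_n) : (i < j)%N -> (x i <= x j)%O.
  by move=> ij; have /forallP/(_ j)/implyP := sx i; apply; exact: ltnW.
by move=> /orP[]/andP[/le]; rewrite leNgt => /negbTE->.
Qed.

End Partner.

(** * Thresholds and the 0-1 principle *)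

Section Threshold.
Context {disp : Order.disp_t} {T : orderType disp}.
Implicit Types (x : {ffun 'I_n -> T}).

Definition thresh (a : T) x : {ffun 'I_n -> bool} := [ffun i => (a <= x i)%O].

Lemma thresh_le a x i j : (x i <= x j)%O -> (thresh a x i <= thresh a x j)%O.
Proof.
by move=> le; rewrite !ffunE; case: (boolP (a <= x i)%O) => //= ai; rewrite (le_trans ai le).
Qed.

Lemma out_of_order_thresh a x p q :
  out_of_order (thresh a x) p q -> out_of_order x p q.
Proof.
have lt i j : (thresh a x i < thresh a x j)%O -> (x i < x j)%O.
  by rewrite !ltNge; apply: contra; exact: thresh_le.
by move=> /orP[]/andP[pq /lt h]; rewrite /out_of_order pq h ?orbT.
Qed.

Lemma out_of_order_thresh_eq a x p q : out_of_order x p q ->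
  ~~ out_of_order (thresh a x) p q -> thresh a x q = thresh a x p.
Proof.
move=> /orP[]/andP[pq /ltW /(thresh_le a) le]; rewrite /out_of_order pq andTb.
  by case/norP => ge _; apply/le_anti; rewrite le leNgt ge.
by case/norP => _ ge; apply/le_anti; rewrite le leNgt ge.
Qed.

(** Thresholding is monotone, so it never creates an out-of-order pair; one that it resolves becomes
    a tie, and swapping tied entries has no effect. *)
Lemma thresh_sort M x a : is_matching M ->
  thresh a (sort_matching M x) = sort_matching M (thresh a x).
Proof.
move=> mM; apply/ffunP => p; rewrite [LHS]ffunE !sort_matchingE.
transitivity (thresh a x (partner M x p)); first by rewrite ffunE.
rewrite {1}/partner; case: pickP => [q /andP[pq o]|E].
  case: (boolP (out_of_order (thresh a x) p q)) => [oq|noq].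
    by rewrite (partner_eq mM pq oq).
  rewrite (out_of_order_thresh_eq o noq).
  rewrite /partner; case: pickP => [q' /andP[pq' oq']|//].
  by rewrite (matching_uniq mM pq pq') oq' in noq.
rewrite /partner; case: pickP => [q /andP[pq oq]|//].
by have := E q; rewrite pq (out_of_order_thresh oq).
Qed.

Lemma thresh_sorted x a : list_sorted x -> list_sorted (thresh a x).
Proof.
move=> /forallP sx; apply/forallP => i; apply/forallP => j; apply/implyP => ij.
by have /forallP/(_ j)/implyP/(_ ij) := sx i; exact: thresh_le.
Qed.

End Threshold.

(** * Inversions of 0-1 lists *)

Section Binary.
Context {R : realDomainType}.
Implicit Types (y : {ffun 'I_n -> bool}).

Definition inverted y (i j : 'I_n) : bool := [&& (i < j)%N, y i & ~~ y j].

Lemma inverted_out_of_order y i j :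
  inverted y i j -> out_of_order y i j.
Proof. by case/and3P => ij yi /negbTE yj; rewrite /out_of_order ij yi yj. Qed.

(** Only the ones carry weight. Following each of them, a one at i moves precisely when it is
    matched with a zero at some j > i, and then gains [w j - w i]. *)
Lemma sum_sort_matching M y (w : 'I_n -> R) : is_matching M ->
  \sum_i w i * (sort_matching M y i)%:R = \sum_i w i * (y i)%:R +
    \sum_i \sum_j (inverted y i j && ([set i; j]%SET \in M))%:R * (w j - w i).
Proof.
move=> mM; rewrite (reindex_inj (can_inj (partnerK y mM))) -big_split/=.
apply: eq_bigr => i _; rewrite sort_matchingE partnerK//.
case yi : (y i); last first.
  rewrite !mulr0 add0r big1// => j _.
  by rewrite /inverted yi andbF mul0r.
rewrite !mulr1; case: (boolP [exists j, inverted y i j && ([set i; j]%SET \in M)]).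
  move=> /existsP[j /andP[ij ijM]].
  rewrite (partner_eq mM ijM (inverted_out_of_order ij)) (bigD1 j)//= big1 => [|k kj].
    by rewrite ij ijM mul1r addr0 addrC subrK.
  case: (boolP ([set i; k]%SET \in M)) => ikM; last by rewrite andbF mul0r.
  by move: kj; rewrite (matching_uniq mM ijM ikM) eqxx.
move=> /existsPn ne; rewrite big1 ?addr0 => [|j _]; last by rewrite (negbTE (ne j)) mul0r.
rewrite /partner; case: pickP => // q /andP[iq].
have := ne q; rewrite iq andbT /inverted yi /out_of_order yi /=.
by case: (y q); case: ltngtP.
Qed.

Definition inversions y : R := \sum_i \sum_j (inverted y i j)%:R.

Lemma sum_ltn (i : 'I_n) : \sum_(j < n) (j < i)%N%:R = (i : nat)%:R :> R.
Proof.
rewrite -natr_sum; congr (_%:R).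
rewrite -(big_mkord xpredT (fun j => (j < i)%N : nat)) (big_cat_nat (n := i))//=; last exact: ltnW.
rewrite big_nat (eq_bigr (fun=> 1%N)) => [|j /andP[_ ->]]//.
rewrite -big_nat sum_nat_const_nat muln1 subn0 [X in (_ + X)%N]big_nat big1 ?addn0//.
by move=> j /andP[ij _]; rewrite ltnNge ij.
Qed.

(* The right-hand side does not depend on how the entries are arranged. *)
Lemma inversions_weight y :
  2 * (inversions y + \sum_(i < n) (i : nat)%:R * (y i)%:R) =
  \sum_i \sum_j (y i)%:R * (2 * (~~ y j)%:R + (y j && (i != j))%:R).
Proof.
(* Writing a position i as the number of j < i turns the position sum into a count of pairs. The
   zeros below a one complete the inversions to all pairs of a one and a zero, and [B] counts the
   pairs of ones. *)
pose B := \sum_(i < n) \sum_(j < n) (y i)%:R * ((y j)%:R * (j < i)%N%:R) : R.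
have BE : 2 * B = \sum_i \sum_j (y i)%:R * (y j && (i != j))%:R.
  rewrite mulr_natl mulr2n {2}/B exchange_big/= -big_split/=; apply: eq_bigr => i _.
  rewrite -big_split/=; apply: eq_bigr => j _.
  rewrite -val_eqE; case: (y i); case: (y j); case: ltngtP => /= _;
    rewrite ?(mulr0, mul0r, mulr1, addr0, add0r)//.
transitivity (2 * (\sum_i \sum_j (y i)%:R * (~~ y j)%:R) + 2 * B); last first.
  rewrite BE mulr_sumr -big_split/=; apply: eq_bigr => i _.
  by rewrite mulr_sumr -big_split/=; apply: eq_bigr => j _; rewrite mulrDr mulrCA.
rewrite -mulrDr; congr (_ * _).
rewrite /B /inversions -!big_split/=; apply: eq_bigr => i _.
rewrite -sum_ltn mulr_suml -!big_split/=; apply: eq_bigr => j _.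
rewrite /inverted; case E : (y i); case F : (y j); case: ltngtP => //= H;
  rewrite ?mulr0 ?mul0r ?mulr1 ?mul1r ?addr0 ?add0r//.
by move: F; rewrite -(val_inj H) E.
Qed.

Lemma inversions_sort_matching M y : is_matching M ->
  inversions (sort_matching M y) = inversions y -
    \sum_i \sum_j (inverted y i j && ([set i; j]%SET \in M))%:R * ((j : nat)%:R - (i : nat)%:R).
Proof.
move=> mM.
have : 2 * (inversions (sort_matching M y) + \sum_(i < n) (i : nat)%:R * (sort_matching M y i)%:R) =
       2 * (inversions y + \sum_(i < n) (i : nat)%:R * (y i)%:R).
  have sI := can_inj (partnerK y mM).
  rewrite !inversions_weight [RHS](reindex_inj sI)/=; apply: eq_bigr => i _.
  rewrite [RHS](reindex_inj sI)/=; apply: eq_bigr => j _.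
  by rewrite !sort_matchingE (inj_eq sI).
move=> /mulfI; rewrite pnatr_eq0 => /(_ isT).
rewrite (sum_sort_matching _ (fun i : 'I_n => (i : nat)%:R)) // => E.
apply/eqP; rewrite eq_sym subr_eq.
by rewrite -(inj_eq (addIr (\sum_(i < n) (i : nat)%:R * (y i)%:R))) -E addrAC addrA.
Qed.

Lemma inversions_ge0 y : 0 <= inversions y.
Proof. by apply: sumr_ge0 => i _; apply: sumr_ge0 => j _; rewrite ler0n. Qed.

Lemma inversions_le y : inversions y <= n%:R ^+ 2.
Proof.
have : inversions y <= \sum_(i < n) \sum_(j < n) 1.
  by apply: ler_sum => i _; apply: ler_sum => j _; rewrite lern1 leq_b1.
by rewrite !sumr_const !card_ord expr2 -[X in _ <= X -> _]mulr_natl.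
Qed.

Lemma inversions_ge1 y i j : inverted y i j -> 1 <= inversions y.
Proof.
move=> ij; rewrite /inversions (bigD1 i)//= (bigD1 j)//= ij -addrA lerDl.
by rewrite addr_ge0// !sumr_ge0// => k _; rewrite ?sumr_ge0// => l _; rewrite ler0n.
Qed.

End Binary.

End Sorting.

(** * The potential of an arbitrary list *)

Section Disorder.
Context {disp : Order.disp_t} {T : orderType disp} {n : nat} {R : realDomainType}.
Implicit Types (x : {ffun 'I_n -> T}).

(** Indexing the thresholds by positions keeps the sum finite for every [T], and counts each value
    as often as it occurs, which a permutation of the entries does not change. *)
Definition disorder x : R := \sum_p inversions (thresh (x p) x).

Lemma disorder_ge0 x : 0 <= disorder x.
Proof. by apply: sumr_ge0 => p _; exact: inversions_ge0. Qed.

Lemma disorder_le x : disorder x <= n%:R ^+ 3.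
Proof.
have : disorder x <= \sum_(p < n) n%:R ^+ 2 by apply: ler_sum => p _; exact: inversions_le.
by rewrite sumr_const card_ord -[X in _ <= X -> _]mulr_natl -exprS.
Qed.

(** Entries x i > x j with i < j form an inversion at the threshold [x i]. *)
Lemma disorder_ge1 x : ~~ list_sorted x -> 1 <= disorder x.
Proof.
move=> /forallPn[i /forallPn[j]]; rewrite negb_imply -ltNge => /andP[ij xji].
rewrite /disorder (bigD1 i)//=; apply: ler_wpDr.
  by apply: sumr_ge0 => p _; exact: inversions_ge0.
apply: (@inversions_ge1 _ _ _ i j); rewrite /inverted !ffunE lexx -ltNge xji.
by rewrite ltn_neqAle ij !andbT; apply: contraTneq xji => /val_inj->; rewrite ltxx.
Qed.

Lemma disorder_sort_matching M x : is_matching M ->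
  disorder (sort_matching M x) = disorder x -
    \sum_p \sum_i \sum_j (inverted (thresh (x p) x) i j && ([set i; j]%SET \in M))%:R
       * ((j : nat)%:R - (i : nat)%:R).
Proof.
move=> mM; rewrite /disorder -sumrB.
rewrite (reindex_inj (can_inj (partnerK x mM)))/=; apply: eq_bigr => p _.
by rewrite sort_matchingE partnerK// thresh_sort// inversions_sort_matching.
Qed.

End Disorder.

(** * Probability that two positions are compared *)

Lemma sum_mixture (R : pzSemiRingType) (S : finType) (I : Type) (r : seq I) (P : pred I)
    (c : I -> R) (F : I -> S -> R) (G : S -> R) :
  \sum_m (\sum_(k <- r | P k) c k * F k m) * G m =
  \sum_(k <- r | P k) c k * \sum_m F k m * G m.
Proof.
under eq_bigr => m _ do rewrite mulr_suml.
rewrite exchange_big/=; apply: eq_bigr => k _.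
by rewrite mulr_sumr; apply: eq_bigr => m _; rewrite mulrA.
Qed.

Section Law.
Context {R : realType} (N : nat).
Hypothesis N1 : (1 < N)%N.
Local Notation n := (2 ^ N)%N.
Local Notation law := (@matching_law R N).

Let Ngt0 : 0 < N%:R :> R. Proof. by rewrite ltr0n ltnW. Qed.

Lemma matching_law_sum (G : {set {set 'I_n}} -> R) :
  \sum_m law m * G m = \sum_(1 <= k < N.+1) N%:R^-1 *
    \sum_(d in dist_range N k) #|dist_range N k|%:R^-1 *
      \sum_(r < 4) 4%:R^-1 * G (sampled_matching N k d r).
Proof.
rewrite sum_mixture; apply: eq_bigr => k _; congr (_ * _).
rewrite sum_mixture; apply: eq_bigr => d _; congr (_ * _).
rewrite sum_mixture; apply: eq_bigr => r _; congr (_ * _).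
rewrite (bigD1 (sampled_matching N k d r))//= eqxx mul1r big1 ?addr0// => m /negbTE->.
by rewrite mul0r.
Qed.

Lemma matching_law_ge0 m : 0 <= law m.
Proof.
apply: sumr_ge0 => k _; rewrite mulr_ge0// sumr_ge0// => d _.
by rewrite mulr_ge0// sumr_ge0// => r _; rewrite mulr_ge0.
Qed.

Lemma matching_law_support m : law m != 0 -> is_matching m.
Proof.
apply: contraNT => mM; rewrite /matching_law big_nat big1// => k; rewrite ltnS => kN.
rewrite big1 ?mulr0// => d dk; rewrite big1 ?mulr0// => r _.
case: eqVneq => [E|_]; last by rewrite mulr0.
by have [] := sampled_matching_spec r N1 kN dk; rewrite -E (negbTE mM).
Qed.

Lemma matching_law_sum_matching (G H : {set {set 'I_n}} -> R) :
  (forall m, is_matching m -> G m = H m) ->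
  \sum_m law m * G m = \sum_m law m * H m.
Proof.
move=> GH; apply: eq_bigr => m _; have [->|/matching_law_support/GH->//] := eqVneq (law m) 0.
by rewrite !mul0r.
Qed.

Lemma matching_law_total : \sum_m law m <= 1.
Proof.
under eq_bigr => m _ do rewrite -[law _]mulr1.
rewrite (matching_law_sum (fun=> 1)).
rewrite [leRHS](_ : _ = \sum_(1 <= k < N.+1) N%:R^-1 * 1); last first.
  by rewrite sumr_const_nat subn1 /= mulr1 -(mulr_natr N%:R^-1) mulVf// gt_eqF.
apply: ler_sum => k _; rewrite ler_wpM2l//.
have -> : \sum_(r < 4) 4%:R^-1 * 1 = 1 :> R.
  by rewrite sumr_const card_ord mulr1 -(mulr_natr 4%:R^-1) mulVf ?pnatr_eq0.
rewrite sumr_const mulr1; have [->|kn] := posnP #|dist_range N k|; first by rewrite mulr0n.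
by rewrite -(mulr_natr (_%:R)^-1) mulVf// pnatr_eq0 -lt0n.
Qed.

Definition rate (i j : 'I_n) : R := \sum_m law m * ([set i; j]%SET \in m)%:R.

(** With D = n/2^k the range is (D/2, D]. Rounding up matters for D = 1, where the range is {1}. *)
Lemma card_dist_range k : (k <= N)%N -> #|dist_range N k| = uphalf (2 ^ (N - k)).
Proof.
move=> kN; set D := (2 ^ (N - k))%N.
have Dn : (D <= n)%N by rewrite leq_exp2l// leq_subr.
have -> : dist_range N k = [set d : 'I_n.+1 | (D./2 < d <= D)%N]%SET.
  by apply/setP => d; rewrite dist_rangeP// inE -/D; lia.
rewrite -sum1_card big_mkcond/=.
rewrite (eq_bigr (fun d : 'I_n.+1 => ((D./2 < d <= D)%N : nat))); last first.
  by move=> d _; rewrite inE; case: ifP.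
rewrite -(big_mkord xpredT (fun d => ((D./2 < d <= D)%N : nat))).
rewrite (big_cat_nat (n := D./2.+1))//=; last by lia.
rewrite big_nat big1 => [|d]; last by lia.
rewrite (big_cat_nat (n := D.+1))//=; [|by lia..].
rewrite [X in (_ + (_ + X))%N]big_nat [X in (_ + (_ + X))%N]big1 => [|d]; last by lia.
rewrite big_nat (eq_bigr (fun=> 1%N)) => [|d]; last by lia.
by rewrite -big_nat sum_nat_const_nat; lia.
Qed.

Lemma dist_range_bounds k (d : 'I_n.+1) : (k <= N)%N -> d \in dist_range N k ->
  (0 < #|dist_range N k| <= d)%N /\ (d <= 2 * #|dist_range N k|)%N.
Proof. by move=> kN; rewrite dist_rangeP// card_dist_range//; lia. Qed.

(** The scale of d is its binary logarithm [e] rounded up, as 2^(e-1) < d <= 2^e; it corresponds to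
    k = N - e, which is positive because d <= n/2. *)
Lemma dist_range_exists d : (0 < d <= 2 ^ N.-1)%N ->
  exists2 k, (0 < k <= N)%N & (inord d : 'I_n.+1) \in dist_range N k.
Proof.
move=> /andP[d0 dN]; pose e := up_log 2 d.
have eN : (e <= N.-1)%N by rewrite up_log_min.
have dn : (d < n.+1)%N by rewrite ltnS (leq_trans dN)// leq_exp2l// leq_pred.
exists (N - e)%N; first by lia.
rewrite dist_rangeP ?leq_subr// inordK//.
have -> : (N - (N - e) = e)%N by lia.
rewrite up_logP// andbT; have [d1|d1] := eqVneq d 1%N; first by rewrite /e d1 up_log1.
have := @up_log_gtn 2 d isT; rewrite ltn_neqAle eq_sym d1 d0 => /(_ isT).
rewrite -/e; clearbody e; case: e eN => [|e] _; rewrite /= ?expn0 1?expnS; lia.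
Qed.

(** A single outcome suffices: level k has probability 1/N, d has probability at least 1/d within
    its range, and one of the four shifts contains the pair. *)
Lemma rate_ge_dist k (d : 'I_n.+1) (u v : 'I_n) : (0 < k <= N)%N ->
  d \in dist_range N k -> pos N (u + d) = v -> (4 * N%:R * d%:R)^-1 <= rate u v.
Proof.
move=> kN dk uv; rewrite /rate matching_law_sum.
have [r0] := sampled_matching_cover u N1 kN dk; rewrite uv => rM.
have [|/andP[c0 cd] _] := dist_range_bounds _ dk; first by case/andP: kN.
have ge0 (A : pred 'I_4) k' d' : 0 <= \sum_(r < 4 | A r) 4%:R^-1 *
    ([set u; v]%SET \in sampled_matching N k' d' r)%:R :> R.
  by rewrite sumr_ge0// => r _; rewrite mulr_ge0.
rewrite (bigD1_seq k) ?iota_uniq//=; last by rewrite mem_index_iota; lia.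
apply: ler_wpDr.
  rewrite sumr_ge0// => k' _; rewrite mulr_ge0// sumr_ge0// => d' _.
  by rewrite mulr_ge0.
rewrite (bigD1 d)//= mulrDr; apply: ler_wpDr.
  by rewrite mulr_ge0// sumr_ge0// => d' _; rewrite mulr_ge0.
rewrite (bigD1 r0)//= rM mulr1 !mulrDr; apply: ler_wpDr.
  by rewrite !mulr_ge0.
rewrite [leRHS](_ : _ = (4 * N%:R * #|dist_range N k|%:R)^-1); last by rewrite !invfM; ring.
have N0 : (0 < N)%N by exact: ltnW.
have d0 := leq_trans c0 cd.
rewrite lef_pV2 ?posrE ?mulr_gt0 ?ltr0n//.
by rewrite ler_wpM2l ?mulr_ge0// ler_nat.
Qed.

Lemma rate_ge (i j : 'I_n) : (i < j)%N ->
  (4 * N%:R)^-1 <= rate i j * ((j : nat)%:R - (i : nat)%:R).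
Proof.
move=> ij; have nE : (n = 2 * 2 ^ N.-1)%N by rewrite -expnS; congr (2 ^ _)%N; lia.
have jn := ltn_ord j.
have D0 : 0 < (j : nat)%:R - (i : nat)%:R :> R by rewrite subr_gt0 ltr_nat.
rewrite -(natrB _ (ltnW ij)) in D0 *.
suff [d d0 dr]: exists2 d, (0 < d <= j - i)%N & (4 * N%:R * d%:R)^-1 <= rate i j.
  rewrite -ler_pdivrMr//; apply: le_trans dr.
  rewrite -invfM lef_pV2 ?posrE ?mulr_gt0 ?ltr0n//; try lia.
  by rewrite ler_wpM2l ?mulr_ge0// ler_nat; case/andP: d0.
case: (leqP (j - i) (2 ^ N.-1)) => ijn.
  have [|k kN dk] := @dist_range_exists (j - i); first by lia.
  exists (j - i)%N; first by lia.
  have dE : (inord (j - i) : 'I_n.+1) = (j - i)%N :> nat by rewrite inordK; lia.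
  rewrite -dE; apply: rate_ge_dist kN dk _.
  by rewrite dE subnKC ?pos_ord// ltnW.
(* Beyond n/2 the pair is reached around the cycle, from j to i, at the distance n - (j - i), which
   is smaller than j - i and so only improves the bound. *)
have [|k kN dk] := @dist_range_exists (n - (j - i)); first by lia.
exists (n - (j - i))%N; first by lia.
have dE : (inord (n - (j - i)) : 'I_n.+1) = (n - (j - i))%N :> nat by rewrite inordK; lia.
rewrite -dE /rate finset.setUC; apply: rate_ge_dist kN dk _.
rewrite dE; have -> : (j + (n - (j - i)) = i + n)%N by lia.
by apply: val_inj; rewrite /= modnDr modn_small.
Qed.

(** The ranges are disjoint dyadic intervals, so e lies in at most one of them, and that one has at
    least e/2 elements. *)
Lemma dist_range_sum_le (e : nat) : (0 < e <= n)%N ->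
  \sum_(1 <= k < N.+1) \sum_(d in dist_range N k) #|dist_range N k|%:R^-1 * (d == e :> nat)%:R
    <= 2 / e%:R :> R.
Proof.
move=> /andP[e0 en]; pose e' : 'I_n.+1 := inord e; pose c k : R := (e' \in dist_range N k)%:R.
have eE : e' = e :> nat by rewrite inordK.
have le k : (1 <= k < N.+1)%N ->
  \sum_(d in dist_range N k) #|dist_range N k|%:R^-1 * (d == e :> nat)%:R
   <= c k * (2 / e%:R) :> R.
  move=> kN; rewrite /c; case: (boolP (_ \in _)) => ek.
    rewrite (bigD1 e')//= eE eqxx mulr1 mul1r big1 ?addr0 => [|d /andP[_ de]].
      have [|/andP[c0 cd] c2] := dist_range_bounds _ ek; first by lia.
      rewrite ler_pdivlMr ?ltr0n// mulrC ler_pdivrMr ?ltr0n//.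
      by rewrite -natrM ler_nat -eE.
    by rewrite -eE val_eqE (negbTE de) mulr0.
  rewrite mul0r big1// => d dk; case: eqP => [de|]; rewrite ?mulr0//.
  move: ek; rewrite (_ : e' = d) ?dk//.
  by apply: ord_inj; rewrite eE.
apply: (@le_trans _ _ (\sum_(1 <= k < N.+1) c k * (2 / e%:R))).
  by rewrite big_nat [leRHS]big_nat; apply: ler_sum.
rewrite -mulr_suml ler_piMl// /c -natr_sum lern1.
have [|] := boolP (has (fun k => e' \in dist_range N k) (index_iota 1 N.+1)).
  move=> /hasP[k]; rewrite mem_index_iota => kN ek.
  rewrite (bigD1_seq k) ?iota_uniq ?mem_index_iota//= big_nat_cond ek big1// => k' /andP[k'N kk'].
  apply/eqP; rewrite eqb0; apply: contra kk' => ek'.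
  move: ek ek'; rewrite !dist_rangeP ?eE; [|lia..].
  move=> /andP[a1 a2] /andP[b1 b2].
  have half a b : (a < b)%N -> (2 * 2 ^ a <= 2 ^ b)%N by move=> ab; rewrite -expnS leq_exp2l.
  case: (ltngtP k k') => // kk.
    by have := half (N - k')%N (N - k)%N ltac:(lia); lia.
  by have := half (N - k)%N (N - k')%N ltac:(lia); lia.
move=> /hasPn h; rewrite big_nat big1// => k kN; apply/eqP; rewrite eqb0.
by apply: h; rewrite mem_index_iota.
Qed.

(** The pair is compared only at the distances j - i and n - (j - i). For i in the upper half the
    second is at least the first, and each occurs with probability at most 2/(N(j - i)). *)
Lemma rate_le (i j : 'I_n) : (i < j)%N -> (n <= 2 * i)%N ->
  rate i j <= 4 / N%:R / ((j : nat)%:R - (i : nat)%:R).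
Proof.
move=> ij ni; rewrite /rate matching_law_sum -(natrB _ (ltnW ij)).
have jn := ltn_ord j.
have le k d : (0 < k <= N)%N -> d \in dist_range N k ->
    \sum_(r < 4) 4%:R^-1 * ([set i; j]%SET \in sampled_matching N k d r)%:R
      <= (d == (j - i)%N :> nat)%:R + (d == (n - (j - i))%N :> nat)%:R :> R.
  move=> kN dk; have :
    \sum_(r < 4) 4%:R^-1 * ((d == (j - i)%N :> nat)%:R + (d == (n - (j - i))%N :> nat)%:R)
     = (d == (j - i)%N :> nat)%:R + (d == (n - (j - i))%N :> nat)%:R :> R.
    by rewrite sumr_const card_ord -(mulr_natr (4%:R^-1 * _)) mulrAC mulVf ?mul1r ?pnatr_eq0.
  move=> <-; apply: ler_sum => r _; rewrite ler_wpM2l// -natrD ler_nat.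
  case: (boolP (_ \in _)) => //= /(sampled_matching_dist ij).
  have dn : (d <= n)%N by rewrite -ltnS.
  by move=> /(_ dn) /orP[]->//; rewrite addn1.
apply: (@le_trans _ _ (N%:R^-1 * (2 / (j - i)%N%:R + 2 / (n - (j - i))%N%:R))); last first.
  have : ((n - (j - i))%N%:R)^-1 <= ((j - i)%N%:R)^-1 :> R.
    by rewrite lef_pV2 ?posrE ?ltr0n ?ler_nat; lia.
  move=> h; rewrite [leRHS]mulrAC mulrC ler_wpM2r//; lra.
apply: (@le_trans _ _ (N%:R^-1 * (\sum_(1 <= k < N.+1) \sum_(d in dist_range N k)
    #|dist_range N k|%:R^-1 * (d == (j - i)%N :> nat)%:R +
   \sum_(1 <= k < N.+1) \sum_(d in dist_range N k)
    #|dist_range N k|%:R^-1 * (d == (n - (j - i))%N :> nat)%:R))); last first.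
  by rewrite ler_wpM2l// lerD// dist_range_sum_le//; lia.
rewrite -mulr_sumr ler_wpM2l// -big_split/= big_nat [leRHS]big_nat; apply: ler_sum => k kN.
rewrite -big_split/=; apply: ler_sum => d dk.
by rewrite -mulrDr ler_wpM2l// le.
Qed.

End Law.

(** * The random process and the sorting time *)

Section Mean.
Context {R : realType} {disp : Order.disp_t} {T : orderType disp} {n : nat}.
Variable q : {set {set 'I_n}} -> R.
Hypothesis q_ge0 : forall m, 0 <= q m.
Implicit Types (x : {ffun 'I_n -> T}) (f g : {ffun 'I_n -> T} -> R).

(** For a law [q], this is the expectation of f after t independent rounds from x, by conditioning
    on the first round. The finite recursion keeps the drift estimates free of measure theory. *)
Fixpoint mean f (t : nat) x : R :=
  if t is t'.+1 then \sum_m q m * mean f t' (sort_matching m x) else f x.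

(** A one-step drift bound for the potential f is iterated on the states satisfying [inv]. In the
    applications g is the indicator of being sorted or unsorted, so that this acts as Markov's
    inequality. *)
Lemma mean_le_expn (inv : {ffun 'I_n -> T} -> Prop) f g (rho : R) t x :
  0 <= rho ->
  (forall m z, inv z -> q m != 0 -> inv (sort_matching m z)) ->
  (forall z, inv z -> g z <= f z) ->
  (forall z, inv z -> \sum_m q m * f (sort_matching m z) <= rho * f z) ->
  inv x -> mean g t x <= rho ^+ t * f x.
Proof.
move=> rho0 invS gf fS; elim: t x => [|t IH] x ix /=; first by rewrite mul1r gf.
apply: (@le_trans _ _ (\sum_m q m * (rho ^+ t * f (sort_matching m x)))).
  apply: ler_sum => m _; have [->|qm] := eqVneq (q m) 0; first by rewrite !mul0r.
  by rewrite ler_wpM2l// IH//; exact: invS.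
under eq_bigr => m _ do rewrite mulrCA.
by rewrite -mulr_sumr exprSr -mulrA ler_wpM2l ?exprn_ge0// fS.
Qed.

End Mean.

(** * The law of the list after t rounds *)

Section Process.
Local Open Scope classical_set_scope.
Context {R : realType} {disp : Order.disp_t} {T : orderType disp} {n : nat}.
Variables (q : {set {set 'I_n}} -> R) (x : {ffun 'I_n -> T}).
Context {d : measure_display} {Om : measurableType d} (P : probability Om R).
Variable M : nat -> Om -> {set {set 'I_n}}.
Hypothesis iidM : iid_law P q M.

Lemma eq_sorter_run (m m' : nat -> {set {set 'I_n}}) t :
  (forall i, (i < t)%N -> m i = m' i) -> sorter_run m x t = sorter_run m' x t.
Proof.
elim: t => //= t IH mm'; rewrite mm'// IH// => i it; apply: mm'.
exact: ltnW.
Qed.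

Let cyl (m : nat -> {set {set 'I_n}}) j t (B : pred {ffun 'I_n -> T}) : set Om :=
  [set w | (forall i, (i < j)%N -> M i w = m i) /\ B (sorter_run (M ^~ w) x (t + j))].

(** [iid_law] speaks of completely prescribed initial segments. Hence the segment of [m] of length j
    is kept general, and the induction on t splits the event by the value of [M j]. *)
Let cyl_prob m j t B : measurable (cyl m j t B) /\
  P (cyl m j t B) =
  ((\prod_(i < j) q (m i)) * mean q (fun z => (B z)%:R) t (sorter_run m x j))%:E.
Proof.
have [mM PM] := iidM.
elim: t m j => [|t IH] m j /=.
  have pE : [set w | forall i, (i < j)%N -> M i w = m i] =
            [set w | forall i : 'I_j, M i w = m i].
    by apply/seteqP; split => w /= h i; [exact: h|move=> ij; exact: (h (Ordinal ij))].
  have mp : measurable [set w | forall i : 'I_j, M i w = m i].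
    have -> : [set w | forall i : 'I_j, M i w = m i] =
        \bigcap_(i in [set: 'I_j]) [set w | M i w = m i].
      by apply/seteqP; split => w /= h i; [move=> _; exact: h|exact: (h i Logic.I)].
    by apply: fin_bigcap_measurable => // i _; exact: mM.
  (* The prescribed matchings determine the list, so the event is the whole cylinder or empty. *)
  case Bx : (B (sorter_run m x j)).
    have -> : cyl m j 0 B = [set w | forall i : 'I_j, M i w = m i].
      rewrite -pE; apply/seteqP; split => w /=; first by case.
      by move=> h; split => //; rewrite add0n (eq_sorter_run h).
    by split => //; rewrite (PM j (fun i => m i)) mulr1.
  have -> : cyl m j 0 B = set0.
    by apply/seteqP; split => w //= [h]; rewrite add0n (eq_sorter_run h) Bx.
  by split => //; rewrite measure0 mulr0.
(* [m' s] prolongs the first j matchings of [m] by the value [s] at index j. *)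
pose m' s i := if (i < j)%N then m i else s.
have m'E s i : (i < j)%N -> m' s i = m i by rewrite /m' => ->.
have cE : cyl m j t.+1 B =
    \bigcup_(s in [set` index_enum {set {set 'I_n}}]) cyl (m' s) j.+1 t B.
  apply/seteqP; split => w /=.
    move=> [h Bw]; exists (M j w); first exact: mem_index_enum.
    split; last by rewrite addnS -addSn.
    move=> i; rewrite ltnS leq_eqVlt => /orP[/eqP->|ij]; first by rewrite /m' ltnn.
    by rewrite m'E// h.
  move=> [s _ [h Bw]]; split; last by rewrite addSn -addnS.
  by move=> i ij; rewrite h ?m'E// ltnW.
have tc : trivIset [set` index_enum {set {set 'I_n}}] (fun s => cyl (m' s) j.+1 t B).
  move=> s s' _ _ [w [[h _] [h' _]]].
  by have := h j (ltnSn j); rewrite (h' j (ltnSn j)) /m' ltnn.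
rewrite cE; split.
  by apply: fin_bigcup_measurable => // s _; have [] := IH (m' s) j.+1.
rewrite measure_fin_bigcup//; last by move=> s _; have [] := IH (m' s) j.+1.
rewrite -fsbig_seq ?index_enum_uniq// mulr_sumr -sumEFin; apply: eq_bigr => s _.
apply: etrans (proj2 (IH (m' s) j.+1)) _; congr EFin.
rewrite big_ord_recr/= {2}/m' ltnn -mulrA; congr (_ * _).
  by apply: eq_bigr => i _; rewrite m'E.
rewrite /= {1}/m' ltnn; congr (_ * mean _ _ _ (sort_matching _ _)).
by apply: eq_sorter_run => i; exact: m'E.
Qed.

Lemma run_event t (B : pred {ffun 'I_n -> T}) :
  measurable [set w | B (sorter_run (M ^~ w) x t)] /\
  P [set w | B (sorter_run (M ^~ w) x t)] = (mean q (fun z => (B z)%:R) t x)%:E.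
Proof.
have [] := cyl_prob (fun=> finset.set0) 0 t B; rewrite big_ord0 mul1r /=.
have -> // : cyl (fun=> finset.set0) 0 t B = [set w | B (sorter_run (M ^~ w) x t)].
by apply/seteqP; split => w; rewrite /cyl /= addn0 => // -[].
Qed.

End Process.

(** * The sorting time as a sum of tail indicators *)

Section SortingTime.
Local Open Scope classical_set_scope.
Context {R : realType} {disp : Order.disp_t} {T : orderType disp} {n : nat}.
Variable (x : {ffun 'I_n -> T}).
Implicit Types (m : nat -> {set {set 'I_n}}).

Lemma sorted_run_le m s t : (s <= t)%N ->
  list_sorted (sorter_run m x s) -> list_sorted (sorter_run m x t).
Proof.
move=> /subnK <- h; elim: (t - s)%N => //= k IH.
by rewrite sort_sorted.
Qed.

Lemma sorting_time_le m t : list_sorted (sorter_run m x t) ->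
  (sorting_time R m x <= t%:R%:E)%E.
Proof. by move=> h; apply: ereal_inf_lbound; exists t. Qed.

(** Sorting times are integers or infinite, so one below a < t + 1 is at most t. *)
Lemma sorting_time_lt m t (a : R) : a < t.+1%:R ->
  (sorting_time R m x < a%:E)%E -> list_sorted (sorter_run m x t).
Proof.
move=> at1 /ereal_inf_lt[_ [s /= hs <-]]; rewrite lte_fin => sa.
by apply: sorted_run_le hs; rewrite -ltnS -(ltr_nat R) (lt_trans sa).
Qed.

(** Once sorted the list stays sorted, so the sorting time counts the unsorted instants; a list that
    is never sorted gives +oo on both sides. *)
Lemma sorting_time_series m : sorting_time R m x =
  (\sum_(0 <= t <oo) (~~ list_sorted (sorter_run m x t))%:R%:E)%E.
Proof.
have ge0 k : (0 <= (~~ list_sorted (sorter_run m x k))%:R%:E :> \bar R)%E.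
  by rewrite lee_fin ler0n.
have [[t0 st0]|ns] := pselect (exists t, list_sorted (sorter_run m x t)).
  pose t := ex_minn (ex_intro (fun t => list_sorted (sorter_run m x t)) t0 st0).
  have [st tmin] : list_sorted (sorter_run m x t) /\
      forall s, list_sorted (sorter_run m x s) -> (t <= s)%N.
    by rewrite /t; case: ex_minnP.
  rewrite (@nneseries_split _ _ 0 t)// add0n [X in (_ + X)%E]eseries0 => [|k tk _]; last first.
    by rewrite (sorted_run_le tk st).
  rewrite adde0 big_nat (eq_bigr (fun=> 1%:E)) => [|s /andP[_ st']]; last first.
    by case: (boolP (list_sorted _)) => // /tmin; rewrite leqNgt st'.
  rewrite -big_nat sumEFin sumr_const_nat subn0.
  apply/eqP; rewrite eq_le sorting_time_le//=.
  by apply: le_ereal_inf_tmp => _ [s /= ss <-]; rewrite lee_fin ler_nat tmin.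
have -> : sorting_time R m x = +oo%E.
  rewrite /sorting_time (_ : [set t | list_sorted _] = set0) ?image_set0 ?ereal_inf0//.
  by apply/seteqP; split => // t st; case: ns; exists t.
apply/esym/eq_infty => r; have [k rk] : exists k, (r <= k%:R).
  by exists (Num.truncn r).+1; rewrite ltW// truncnS_gt.
apply: (le_trans _ (@nneseries_lim_ge _ _ xpredT 0 k _)) => //.
rewrite (eq_bigr (fun=> 1%:E)) => [|s _]; last first.
  by case: (boolP (list_sorted _)) => // ss; case: ns; exists s.
by rewrite sumEFin sumr_const_nat subn0 lee_fin.
Qed.

Variables (q : {set {set 'I_n}} -> R).
Context {d : measure_display} {Om : measurableType d} (P : probability Om R).
Variable M : nat -> Om -> {set {set 'I_n}}.
Hypothesis iidM : iid_law P q M.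

Definition unsorted_prob t : R := mean q (fun z => (~~ list_sorted z)%:R) t x.
Definition sorted_prob t : R := mean q (fun z => (list_sorted z)%:R) t x.

Let unsorted t w : \bar R := (~~ list_sorted (sorter_run (M ^~ w) x t))%:R%:E.

Let unsorted_indic t :
  unsorted t = EFin \o \1_[set w | ~~ list_sorted (sorter_run (M ^~ w) x t)].
Proof.
apply/funext => w; rewrite /unsorted/= indicE; congr (nat_of_bool _)%:R%:E.
by apply/idP/idP => [h|/set_mem//]; exact: mem_set.
Qed.

Let measurable_unsorted t : measurable_fun setT (unsorted t).
Proof.
rewrite unsorted_indic; apply/measurable_EFinP; apply: measurable_indic.
by have [] := run_event x iidM t (fun z => ~~ list_sorted z).
Qed.

Lemma measurable_sorting_time : measurable_fun setT (fun w => sorting_time R (M ^~ w) x).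
Proof.
under eq_fun do rewrite sorting_time_series.
apply: (@ge0_emeasurable_sum _ _ _ _ unsorted xpredT) => [k w _ _|k _].
  by rewrite lee_fin.
exact: measurable_unsorted.
Qed.

Lemma integral_sorting_time :
  (\int[P]_w sorting_time R (M ^~ w) x = \sum_(0 <= t <oo) (unsorted_prob t)%:E)%E.
Proof.
under eq_integral do rewrite sorting_time_series.
rewrite (@integral_nneseries _ _ _ _ _ _ unsorted)//; last by move=> k w _; rewrite lee_fin.
apply: eq_eseriesr => t _; rewrite unsorted_indic integral_indic ?setIT//.
all: by have [] := run_event x iidM t (fun z => ~~ list_sorted z).
Qed.

Lemma sorting_time_gt_prob t (a : R) : t%:R <= a ->
  (P [set w | (a%:E < sorting_time R (M ^~ w) x)%E] <= (unsorted_prob t)%:E)%E.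
Proof.
move=> ta; have [mE <-] := run_event x iidM t (fun z => ~~ list_sorted z).
apply: le_measure; rewrite ?inE//.
  rewrite -[X in measurable X]setTI; apply: emeasurable_fun_o_infty => //.
  exact: measurable_sorting_time.
move=> w /=; apply: contraTN => /sorting_time_le h; rewrite -leNgt (le_trans h)//.
Qed.

Lemma sorting_time_lt_prob t (a : R) : a < t.+1%:R ->
  (P [set w | (sorting_time R (M ^~ w) x < a%:E)%E] <= (sorted_prob t)%:E)%E.
Proof.
move=> ta; have [mE <-] := run_event x iidM t (@list_sorted _ _ _).
apply: le_measure; rewrite ?inE//.
  rewrite -[X in measurable X]setTI; apply: emeasurable_fun_infty_o => //.
  exact: measurable_sorting_time.
by move=> w /=; exact: sorting_time_lt.
Qed.

(** The complement is taken in the probability space, which supplies the total mass 1. *)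
Lemma unsorted_probE t : unsorted_prob t = 1 - sorted_prob t.
Proof.
have [mS PS] := run_event x iidM t (@list_sorted _ _ _).
have [_ PU] := run_event x iidM t (fun z => ~~ list_sorted z).
apply: EFin_inj; rewrite EFinB -/(sorted_prob t) in PS *; rewrite -PS -PU -probability_setC//.
by congr (P _); apply/seteqP; split => w /= /negP.
Qed.

End SortingTime.

(** * Contraction of the potentials *)

Section Contraction.
Context {R : realType} {disp : Order.disp_t} {T : orderType disp} (N : nat).
Hypothesis N1 : (1 < N)%N.
Local Notation n := (2 ^ N)%N.
Local Notation law := (@matching_law R N).
Implicit Types (x : {ffun 'I_n -> T}).

Lemma sum_rate (F : 'I_n -> 'I_n -> R) (p : rel 'I_n) :
  \sum_m law m * (\sum_i \sum_j (p i j && ([set i; j]%SET \in m))%:R * F i j) =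
  \sum_i \sum_j (p i j)%:R * (rate i j * F i j).
Proof.
under eq_bigr => m _ do rewrite mulr_sumr.
rewrite exchange_big/=; apply: eq_bigr => i _.
under eq_bigr => m _ do rewrite mulr_sumr.
rewrite exchange_big/=; apply: eq_bigr => j _.
rewrite mulr_suml mulr_sumr; apply: eq_bigr => m _.
by rewrite -mulnb natrM; ring.
Qed.

(** At each threshold, an inverted pair lowers the inversions in mean by its rate times j - i, hence
    by at least 1/(4N) by [rate_ge]; summed over the inverted pairs this is a fixed proportion of
    the potential. *)
Lemma disorder_contraction x :
  \sum_m law m * disorder (sort_matching m x) <= (1 - (4 * N%:R)^-1) * disorder x.
Proof.
rewrite (matching_law_sum_matching N1 (fun m => @disorder_sort_matching _ _ _ _ m x)).
under eq_bigr => m _ do rewrite mulrBr.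
rewrite sumrB -mulr_suml mulrBl mul1r lerB//.
  by rewrite ler_piMl ?disorder_ge0 ?matching_law_total.
under eq_bigr => m _ do rewrite mulr_sumr.
rewrite exchange_big/= /disorder mulr_sumr; apply: ler_sum => p _.
rewrite sum_rate /inversions mulr_sumr; apply: ler_sum => i _.
rewrite mulr_sumr; apply: ler_sum => j _.
rewrite mulrC; case: (boolP (inverted _ i j)) => [/and3P[ij _ _]|_]; last by rewrite !mul0r.
by rewrite !mul1r rate_ge.
Qed.

Lemma unsorted_prob_le1 x t : unsorted_prob x law t <= 1.
Proof.
rewrite -[leRHS](expr1n _ t) -[leRHS]mulr1.
apply: (mean_le_expn (@matching_law_ge0 R N) (inv := fun=> True) (f := fun=> 1)) => // z _.
  by rewrite lern1 leq_b1.
under eq_bigr => m _ do rewrite mulr1.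
by rewrite mulr1 matching_law_total.
Qed.

Lemma unsorted_prob_ge0 x t : 0 <= unsorted_prob x law t.
Proof.
rewrite /unsorted_prob; elim: t x => [|t IH] x /=; first by rewrite ler0n.
by rewrite sumr_ge0// => m _; rewrite mulr_ge0 ?matching_law_ge0.
Qed.

Lemma unsorted_prob_le x t :
  unsorted_prob x law t <= (1 - (4 * N%:R)^-1) ^+ t * n%:R ^+ 3.
Proof.
have rho0 : 0 <= 1 - (4 * N%:R)^-1 :> R.
  have N4 : (0 < 4 * N)%N by move: N1; lia.
  by rewrite -natrM subr_ge0 invf_le1 ?ler1n// ltr0n.
apply: (@le_trans _ _ ((1 - (4 * N%:R)^-1) ^+ t * disorder x)); last first.
  by rewrite ler_wpM2l ?exprn_ge0// disorder_le.
apply: (mean_le_expn (@matching_law_ge0 R N) (inv := fun=> True)) => // z _.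
  case: (boolP (list_sorted z)) => [_|nz]; first exact: disorder_ge0.
  exact: disorder_ge1.
exact: disorder_contraction.
Qed.

End Contraction.

(** * A slowly growing weight for the lower bound *)

Section Growth.
Context {R : realType} {disp : Order.disp_t} {T : orderType disp} (N : nat).
Hypothesis N1 : (1 < N)%N.
Local Notation n := (2 ^ N)%N.
Local Notation law := (@matching_law R N).
Implicit Types (x : {ffun 'I_n -> T}).

(** The exponent -1/2 balances two demands: the weights above i sum to at most the order of
    [(n - i) * weight i], and the weight at n/2 is polynomially smaller than the weight 1 of the
    last position. *)
Definition weight (i : nat) : R := (Num.sqrt (n - i)%:R)^-1.

Let sqrt_gt0 (i : 'I_n) : 0 < Num.sqrt (n - i)%:R :> R.
Proof. by rewrite sqrtr_gt0 ltr0n subn_gt0. Qed.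

Lemma weight_ge0 i : 0 <= weight i.
Proof. by rewrite invr_ge0 sqrtr_ge0. Qed.

Lemma weight_diff_le (i j : 'I_n) : (i < j)%N ->
  (weight j - weight i) / ((j : nat)%:R - (i : nat)%:R) <= weight j / (n - i)%:R.
Proof.
move=> ij; have jn := ltn_ord j.
have := sqrt_gt0 i; have := sqrt_gt0 j; rewrite /weight.
have dE : (j : nat)%:R - (i : nat)%:R = (n - i)%:R - (n - j)%:R :> R.
  by rewrite (natrB _ (ltnW (ltn_ord i))) (natrB _ (ltnW jn)); ring.
have cb : Num.sqrt (n - j)%:R < Num.sqrt (n - i)%:R :> R.
  by rewrite ltr_sqrt ?ltr_nat ?ltn_sub2l ?ltr0n ?subn_gt0//; lia.
have bE : (n - i)%:R = Num.sqrt (n - i)%:R ^+ 2 :> R by rewrite sqr_sqrtr.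
have cE : (n - j)%:R = Num.sqrt (n - j)%:R ^+ 2 :> R by rewrite sqr_sqrtr.
rewrite {}dE; move: cb bE cE; move: (Num.sqrt (n - i)%:R) (Num.sqrt (n - j)%:R).
move=> b c cb -> -> c0 b0.
(* With b and c the square roots of n - i and n - j, the factor b - c cancels; then b + c is bounded
   below by b. *)
have -> : (c^-1 - b^-1) / (b ^+ 2 - c ^+ 2) = (c * b * (b + c))^-1.
  have d0 : 0 < b ^+ 2 - c ^+ 2 by rewrite subr_sqr mulr_gt0 ?subr_gt0 ?addr_gt0.
  by field; rewrite !gt_eqF// addr_gt0.
have -> : c^-1 / b ^+ 2 = (c * b * b)^-1 by field; rewrite !gt_eqF.
have cb0 : 0 < c * b by rewrite mulr_gt0.
rewrite lef_pV2 ?posrE ?(mulr_gt0 cb0)//; last by rewrite addr_gt0.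
by rewrite (ler_wpM2l (ltW cb0))// lerDl (ltW c0).
Qed.

(** Discrete form of an integral comparison: each weight is at most an increment of -2 sqrt(n - k),
    and the increments telescope. *)
Lemma sum_weight_le (i : 'I_n) :
  \sum_(j < n | (i < j)%N) weight j <= 2 * Num.sqrt (n - i)%:R.
Proof.
pose h k : R := - (2 * Num.sqrt (n - k)%:R).
have wh (j : nat) : (j < n)%N -> weight j <= h j.+1 - h j.
  move=> jn; rewrite /weight /h subnS; have : (0 < n - j)%N by rewrite subn_gt0.
  case: (n - j)%N => // c _ /=.
  have s0 : 0 < Num.sqrt c.+1%:R :> R by rewrite sqrtr_gt0.
  have r0 : 0 <= Num.sqrt c%:R :> R by exact: sqrtr_ge0.
  have sE : Num.sqrt c.+1%:R ^+ 2 = Num.sqrt c%:R ^+ 2 + 1 :> R.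
    by rewrite !sqr_sqrtr// natr1.
  rewrite -[leLHS]mul1r ler_pdivrMr//; nra.
rewrite (eq_bigl (fun j : 'I_n => (i < j)%N)) // -(big_mkord (fun j => (i < j)%N)).
rewrite (big_cat_nat (n := i.+1))//= big_nat_cond big1 ?add0r => [|k]; last by lia.
apply: (@le_trans _ _ (\sum_(i.+1 <= k < n) (h k.+1 - h k))).
  rewrite big_mkcond big_nat [leRHS]big_nat; apply: ler_sum => k /andP[ik kn].
  by rewrite ik wh.
rewrite telescope_sumr// /h subnn sqrtr0 mulr0 oppr0 sub0r opprK.
by rewrite ler_wpM2l// ler_sqrt// ler_nat leq_sub2l.
Qed.

(** The factor 1/(j - i) of [rate_le] turns the weight difference into a quotient of at most
    [weight j / (n - i)]. These quotients sum to at most 2/sqrt(n - i), which is twice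
    [weight i]. *)
Lemma drift_le (i : 'I_n) : (n <= 2 * i)%N ->
  \sum_(j < n | (i < j)%N) rate i j * (weight j - weight i) <= 8 / N%:R * weight i.
Proof.
move=> ni; apply: (@le_trans _ _ (\sum_(j < n | (i < j)%N) 4 / N%:R * (weight j / (n - i)%:R))).
  apply: ler_sum => j ij.
  have D0 : 0 < (j : nat)%:R - (i : nat)%:R :> R by rewrite subr_gt0 ltr_nat.
  have w0 : 0 <= weight j - weight i.
    rewrite subr_ge0 /weight lef_pV2 ?posrE ?sqrt_gt0//.
    by rewrite ler_sqrt// ler_nat leq_sub2l// ltnW.
  apply: (@le_trans _ _ (4 / N%:R / ((j : nat)%:R - (i : nat)%:R) * (weight j - weight i))).
    by rewrite ler_wpM2r// rate_le.
  by rewrite -mulrA [_^-1 * _]mulrC ler_wpM2l ?divr_ge0// weight_diff_le.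
rewrite -mulr_sumr -mulr_suml.
have -> : 8 / N%:R * weight i = 4 / N%:R * (2 * Num.sqrt (n - i)%:R / (n - i)%:R).
  have bE : (n - i)%:R = Num.sqrt (n - i)%:R ^+ 2 :> R by rewrite sqr_sqrtr.
  have N0 : N%:R != 0 :> R by rewrite pnatr_eq0 -lt0n ltnW.
  rewrite /weight; move: bE (sqrt_gt0 i); move: (Num.sqrt _) => b -> b0.
  by field; rewrite N0 gt_eqF.
by rewrite ler_wpM2l ?divr_ge0// ler_wpM2r// sum_weight_le.
Qed.

Variable a : T.

(* In the upper half [n - (j - i) >= j - i], so that comparisons across the
   boundary do not speed up the process. *)
Definition high_in_upper_half x : Prop :=
  (exists i, thresh a x i) /\ forall i, thresh a x i -> (n <= 2 * i)%N.

Definition high_weight x : R := \sum_(i < n) weight i * (thresh a x i)%:R.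

(** A high entry is only ever exchanged with a low one further right, so it never moves down. *)
Lemma high_in_upper_half_sort M x : is_matching M ->
  high_in_upper_half x -> high_in_upper_half (sort_matching M x).
Proof.
move=> mM [[i yi] yh]; rewrite /high_in_upper_half thresh_sort//; split.
  by exists (partner M (thresh a x) i); rewrite sort_matchingE partnerK.
move=> p; rewrite sort_matchingE /partner; case: pickP => [q /andP[_ o] yq|_]; last exact: yh.
have := yh _ yq; move: o; rewrite /out_of_order yq.
case: ltngtP => //= qp; last by lia.
by rewrite orbF; case: (thresh a x p).
Qed.

Lemma high_weight_sorted x : high_in_upper_half x -> list_sorted x -> 1 <= high_weight x.
Proof.
move=> [[i yi] _] /(thresh_sorted a)/forallP/(_ i)/forallP sx.
have ln : (n.-1 < n)%N by rewrite prednK ?expn_gt0.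
have /implyP := sx (Ordinal ln); rewrite /= -ltnS prednK ?expn_gt0// ltn_ord yi => /(_ isT).
case yl : (thresh a x (Ordinal ln)) => // _.
rewrite /high_weight (bigD1 (Ordinal ln))//= yl mulr1.
have -> : weight n.-1 = 1.
  rewrite /weight (_ : n - n.-1 = 1)%N ?sqrtr1 ?invr1//.
  by have := pow2_gt0 N; lia.
by rewrite lerDl sumr_ge0// => j _; rewrite mulr_ge0// weight_ge0.
Qed.

(** A high entry at i gains only from positions j > i holding a low entry. The increments are
    nonnegative, so the sum may be extended to all j > i, where [drift_le] applies. *)
Lemma high_weight_growth x : high_in_upper_half x ->
  \sum_m law m * high_weight (sort_matching m x) <= (1 + 8 / N%:R) * high_weight x.
Proof.
move=> [_ yh]; set y := thresh a x.
rewrite (matching_law_sum_matching N1 (H := fun m => high_weight x +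
  \sum_(i < n) \sum_(j < n) (inverted y i j && ([set i; j]%SET \in m))%:R *
    (weight j - weight i))); last first.
  move=> m mM; rewrite /high_weight thresh_sort//.
  by rewrite (sum_sort_matching _ (fun i : 'I_n => weight i)).
under eq_bigr => m _ do rewrite mulrDr.
rewrite big_split/= sum_rate -mulr_suml mulrDl mul1r lerD//.
  rewrite ler_piMl ?matching_law_total// sumr_ge0// => i _.
  by rewrite mulr_ge0// weight_ge0.
rewrite mulr_sumr; apply: ler_sum => i _; rewrite -/y.
case yi : (y i); last first.
  by rewrite !mulr0 big1// => j _; rewrite /inverted yi andbF mul0r.
rewrite mulr1; apply: le_trans (drift_le (yh i yi)).
rewrite [leRHS]big_mkcond/=; apply: ler_sum => j _.
rewrite /inverted yi /=; case: ifP => ij; last by rewrite mul0r.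
have r0 : 0 <= rate i j * (weight j - weight i).
  rewrite mulr_ge0//.
    by rewrite sumr_ge0// => m _; rewrite mulr_ge0// matching_law_ge0.
  rewrite subr_ge0 /weight lef_pV2 ?posrE ?sqrt_gt0//.
  by rewrite ler_sqrt// ler_nat leq_sub2l// ltnW.
by case: (y j); rewrite /= ?mul0r ?mul1r.
Qed.

Lemma sorted_prob_le x t : high_in_upper_half x ->
  sorted_prob x law t <= (1 + 8 / N%:R) ^+ t * high_weight x.
Proof.
have rho0 : 0 <= 1 + 8 / N%:R :> R by rewrite addr_ge0// divr_ge0.
apply: (mean_le_expn (@matching_law_ge0 R N) t rho0).
- by move=> m z hz /(matching_law_support N1) mM; exact: high_in_upper_half_sort.
- move=> z hz; case: (boolP (list_sorted z)) => [sz|_]; first exact: high_weight_sorted.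
  by rewrite sumr_ge0// => i _; rewrite mulr_ge0// weight_ge0.
- exact: high_weight_growth.
Qed.

End Growth.

(** * Upper and lower bounds *)

Lemma nat_floor_ex (R : realType) (a : R) : 0 <= a ->
  exists2 t : nat, t%:R <= a & a < t.+1%:R.
Proof. by move=> /truncn_itv/andP[le lt]; exists (Num.truncn a). Qed.

Section Bounds.
Context {R : realType} (N : nat).
Hypothesis N1 : (1 < N)%N.
Local Notation n := (2 ^ N)%N.
Local Notation law := (@matching_law R N).
Local Notation l := (ln n%:R : R).

Let Ngt0 : 0 < N%:R :> R. Proof. by rewrite ltr0n ltnW. Qed.

Lemma expR_ln_pow2 : expR l = n%:R.
Proof. by rewrite lnK// posrE ltr0n expn_gt0. Qed.

(** As l = N ln 2 with 1/2 <= ln 2 <= 1, the parameters N and ln n are interchangeable up to a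
    factor 2. *)
Lemma ln_pow2_bounds : [/\ 1 <= l, l <= N%:R & N%:R <= 2 * l].
Proof.
have le1 : ln 2 <= 1 :> R.
  by rewrite -[2]/(1 + 1) le_ln1Dx//; lra.
have ge1 : 1 <= 2 * ln 2 :> R.
  have : ln (1 + - 2^-1) <= - 2^-1 :> R by rewrite le_ln1Dx//; lra.
  rewrite (_ : 1 + - 2^-1 = 2^-1) ?lnV ?posrE//; lra.
have lE : l = N%:R * ln 2 by rewrite natrX lnXn// mulr_natl.
have N2 : 2 <= N%:R :> R by rewrite ler_nat.
by rewrite lE; split; nra.
Qed.

(** * Upper bounds for every list *)

Section Upper.
Context {disp : Order.disp_t} {T : orderType disp} (x : {ffun 'I_n -> T}).
Local Notation rho := (1 - (4 * N%:R)^-1 : R).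

Let rho_ge0 : 0 <= rho.
Proof.
rewrite subr_ge0 invf_le1 ?mulr_gt0//.
have : 2 <= N%:R :> R by rewrite ler_nat.
by lra.
Qed.

(** The first t rounds pay for the initial potential: since N <= 2l, 56 l^2 / (4N) >= 7l, of which
    3l absorbs n^3 = exp(3l) and 4l is left over. *)
Lemma unsorted_prob_tail t k : 56 * l ^+ 2 <= t%:R ->
  unsorted_prob x law (t + k) <= rho ^+ k * expR (- (4 * l)).
Proof.
move=> tl; have [l1 lN Nl] := ln_pow2_bounds.
have N4 : 0 < 4 * N%:R :> R by rewrite mulr_gt0.
apply: le_trans (unsorted_prob_le N1 x (t + k)) _.
rewrite addnC exprD -mulrA ler_wpM2l ?exprn_ge0//.
apply: (@le_trans _ _ (expR (- (4 * N%:R)^-1) ^+ t * expR l ^+ 3)).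
  rewrite expR_ln_pow2 ler_wpM2r// ?exprn_ge0// lerXn2r ?nnegrE ?expR_ge0//.
  exact: expR_ge1Dx.
rewrite -!expRM_natl -expRD ler_expR.
have : 7 * l <= t%:R * (4 * N%:R)^-1 by rewrite ler_pdivlMr//; nra.
by rewrite mulrN; lra.
Qed.

(** About 64 l^2 initial rounds are bounded by 1 each; the later ones are dominated by a geometric
    series of sum 4N <= 8 l^2. *)
Lemma unsorted_prob_sum k :
  \sum_(0 <= t < k) unsorted_prob x law t <= 72 * l ^+ 2.
Proof.
have [l1 lN Nl] := ln_pow2_bounds.
have l2 : 1 <= l ^+ 2 by rewrite exprn_ege1.
(* The surplus of 64 over 56 leaves room for rounding down: t0 > 64 l^2 - 1 >= 56 l^2. *)
have [|t0 t0le t0gt] := @nat_floor_ex R (64 * l ^+ 2); first by lra.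
apply: (@le_trans _ _ (\sum_(0 <= t < t0 + k) unsorted_prob x law t)).
  rewrite [leRHS](big_cat_nat (n := k))//= ?leq_addl// lerDl.
  by rewrite sumr_ge0// => t _; exact: unsorted_prob_ge0.
suff : \sum_(0 <= t < t0 + k) unsorted_prob x law t <= t0%:R + 4 * N%:R * (1 - rho ^+ k).
  move/le_trans; apply.
  by have : 0 <= rho ^+ k; [rewrite exprn_ge0|nra].
elim: k => [|k IH].
  rewrite addn0 expr0 subrr mulr0 addr0.
  apply: (@le_trans _ _ (\sum_(0 <= t < t0) 1)).
    by apply: ler_sum => t _; exact: unsorted_prob_le1.
  by rewrite sumr_const_nat subn0.
rewrite addnS big_nat_recr//=.
have : unsorted_prob x law (t0 + k) <= rho ^+ k.
  apply: (@le_trans _ _ (rho ^+ k * expR (- (4 * l)))).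
    by apply: unsorted_prob_tail; rewrite -natr1 in t0gt; lra.
  by rewrite ler_piMr ?exprn_ge0// expR_le1; lra.
have -> : 4 * N%:R * (1 - rho ^+ k.+1) = 4 * N%:R * (1 - rho ^+ k) + rho ^+ k.
  by rewrite exprS; field; rewrite gt_eqF.
move: IH; lra.
Qed.

End Upper.

(** * The lower bound from a single spike *)

Definition spike : {ffun 'I_n -> nat} := [ffun i : 'I_n => (i == (2 ^ N.-1)%N :> nat) : nat].

Lemma thresh_spike (i : 'I_n) : thresh 1%N spike i = (i == (2 ^ N.-1)%N :> nat).
Proof. by rewrite !ffunE; case: (_ == _). Qed.

Let half_lt : (2 ^ N.-1 < n)%N. Proof. by rewrite ltn_exp2l// prednK// ltnW. Qed.
Let halfE : (n = 2 * 2 ^ N.-1)%N. Proof. by rewrite -expnS prednK// ltnW. Qed.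

Lemma spike_high : high_in_upper_half 1%N spike.
Proof.
split; first by exists (Ordinal half_lt); rewrite thresh_spike.
by move=> i; rewrite thresh_spike => /eqP->; rewrite -halfE.
Qed.

(** The weight of the spike is (n/2)^(-1/2), which is at most n^(-1/4) as soon as n >= 4. *)
Lemma spike_weight : high_weight 1%N spike <= expR (- (l / 4)) :> R.
Proof.
have [l1 lN Nl] := ln_pow2_bounds.
rewrite /high_weight (bigD1 (Ordinal half_lt))//= big1 ?addr0 => [|i]; last first.
  by rewrite thresh_spike -val_eqE => /negbTE/= ->; rewrite mulr0.
rewrite thresh_spike eqxx mulr1 /weight expRN lef_pV2 ?posrE ?expR_gt0//; last first.
  by rewrite sqrtr_gt0 ltr0n subn_gt0.
rewrite -[leLHS]ger0_norm ?expR_ge0// -sqrtr_sqr ler_sqrt//.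
have -> : (n - 2 ^ N.-1)%:R = expR l / 2 :> R.
  by rewrite expR_ln_pow2 halfE mul2n -addnn addnK natrD; lra.
rewrite -expRM_natl; have -> : 2 * (l / 4) = l / 2 by lra.
have -> : expR l = expR (l / 2) ^+ 2 by rewrite -expRM_natl; congr expR; lra.
have : 2 <= expR (l / 2) ^+ 1 ^+ 1 :> R.
  rewrite !expr1 -[leLHS](@lnK R) ?posrE// ler_expR.
  have -> : l = N%:R * ln 2 by rewrite natrX lnXn// mulr_natl.
  have : 0 <= ln 2 :> R by rewrite ln_ge0// ler1n.
  have : 2 <= N%:R :> R by rewrite ler_nat.
  by nra.
by rewrite !expr1; nra.
Qed.

(** The growth over t rounds is at most exp(8t/N), and t <= l^2/64 with l <= N makes this at most
    exp(l/8). It uses up half of the exponent l/4 of [spike_weight]. *)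
Lemma spike_sorted_prob t : t%:R <= 64^-1 * l ^+ 2 ->
  sorted_prob spike law t <= expR (- (l / 8)).
Proof.
move=> tl; have [l1 lN Nl] := ln_pow2_bounds.
apply: le_trans (sorted_prob_le N1 t spike_high) _.
apply: (@le_trans _ _ (expR (8 / N%:R) ^+ t * expR (- (l / 4)))).
  have p0 : 0 <= 1 + 8 / N%:R :> R by rewrite addr_ge0// divr_ge0.
  apply: ler_pM; rewrite ?exprn_ge0//.
  - by rewrite sumr_ge0// => i _; rewrite mulr_ge0// weight_ge0.
  - by rewrite lerXn2r ?nnegrE ?expR_ge0// expR_ge1Dx.
  - exact: spike_weight.
rewrite -expRM_natl -expRD ler_expR mulrA.
have : t%:R * 8 / N%:R <= l / 8 by rewrite ler_pdivrMr//; nra.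
by lra.
Qed.

Lemma powR_ln a : n%:R `^ a = expR (a * l).
Proof. by rewrite /powR gt_eqF// ltr0n expn_gt0. Qed.

End Bounds.

Theorem theorem1p8 (R : realType) :
  (forall N k r : nat, (2 <= N)%N -> (1 <= k <= N)%N -> (r < 4)%N ->
     forall d, d \in dist_range N k ->
       is_matching (sampled_matching N k d r) /\
       (4 * #|sampled_matching N k d r|)%N = (2 ^ N)%N) /\
  (exists c C alpha : R, [/\ 0 < c, 0 < C, 0 < alpha &
     forall N : nat, (2 <= N)%N ->
       let n := (2 ^ N)%N in
       (forall (disp : Order.disp_t) (T : orderType disp) (x : {ffun 'I_n -> T})
          (d : measure_display) (Om : measurableType d) (P : probability Om R)
          (M : nat -> Om -> {set {set 'I_n}}),
          iid_law P (@matching_law R N) M ->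
          (\int[P]_w sorting_time R (M ^~ w) x <= (C * ln n%:R ^+ 2)%:E)%E /\
          (P [set w | ((C * ln n%:R ^+ 2)%:E < sorting_time R (M ^~ w) x)%E]%classic
             <= (n%:R `^ (- alpha))%:E)%E) /\
       (exists x : {ffun 'I_n -> nat},
          forall (d : measure_display) (Om : measurableType d)
            (P : probability Om R) (M : nat -> Om -> {set {set 'I_n}}),
          iid_law P (@matching_law R N) M ->
          ((c * ln n%:R ^+ 2)%:E <= \int[P]_w sorting_time R (M ^~ w) x)%E /\
          (P [set w | (sorting_time R (M ^~ w) x < (c * ln n%:R ^+ 2)%:E)%E]%classic
             <= (n%:R `^ (- alpha))%:E)%E)]).
Proof.
split=> [N k r N2 kN _ d dk|]; first exact: sampled_matching_spec.
(* Here 72 comes from [unsorted_prob_sum], 1/8 from [spike_sorted_prob], and 576 = 64 * 9: during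
   the first (ln n)^2/64 rounds the spike is unsorted with probability at least 1/9. *)
exists 576^-1, 72, 8^-1; split=> // N N2 n.
have [l1 lN Nl] := ln_pow2_bounds (R := R) N2.
have l2 : 1 <= ln n%:R ^+ 2 :> R by rewrite exprn_ege1.
have powE : n%:R `^ (- 8^-1) = expR (- (ln n%:R / 8)) :> R.
  by rewrite powR_ln mulNr mulrC.
split=> [disp T x d Om P M iidM|].
  split.
    rewrite (integral_sorting_time x iidM).
    apply: lime_le.
      apply: is_cvg_nneseries => t _ _; rewrite lee_fin.
      exact: unsorted_prob_ge0.
    by apply: nearW => k; rewrite sumEFin lee_fin unsorted_prob_sum.
  have [|t tle tgt] := @nat_floor_ex R (72 * ln n%:R ^+ 2); first by lra.
  apply: le_trans (sorting_time_gt_prob x iidM tle) _.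
  (* Rounding down still leaves t >= 56 (ln n)^2, and exp(-4 ln n) is below the required
     n^(-1/8). *)
  rewrite lee_fin powE -[t]addn0; apply: le_trans (unsorted_prob_tail N2 x 0 _) _.
    by rewrite -natr1 in tgt; lra.
  by rewrite expr0 mul1r ler_expR; lra.
exists (spike N) => d Om P M iidM; split.
  rewrite (integral_sorting_time _ iidM).
  have [|t tle tgt] := @nat_floor_ex R (64^-1 * ln n%:R ^+ 2); first by lra.
  apply: le_trans (@nneseries_lim_ge _ _ xpredT 0 t.+1 _); last first.
    by move=> s _ _; rewrite lee_fin; exact: unsorted_prob_ge0.
  rewrite sumEFin lee_fin.
  apply: (@le_trans _ _ (\sum_(0 <= s < t.+1) 9^-1)).
    by rewrite sumr_const_nat subn0 -[_ *+ t.+1]mulr_natl; lra.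
  rewrite big_nat [leRHS]big_nat; apply: ler_sum => s /andP[_ st].
  rewrite (unsorted_probE _ iidM).
  have : sorted_prob (spike N) (@matching_law R N) s <= expR (- (ln n%:R / 8)).
    by apply: spike_sorted_prob => //; apply: le_trans tle; rewrite ler_nat.
  (* Since ln n >= 1, exp(ln n / 8) >= 1 + 1/8 = 9/8. *)
  have : expR (- (ln n%:R / 8)) <= 8 / 9 :> R.
    rewrite expRN -[leRHS]invrK lef_pV2 ?posrE ?expR_gt0 ?invr_gt0 ?divr_gt0//.
    by apply: le_trans (expR_ge1Dx _); rewrite invf_div; lra.
  lra.
have [|t tle tgt] := @nat_floor_ex R (576^-1 * ln n%:R ^+ 2); first by lra.
apply: le_trans (sorting_time_lt_prob _ iidM tgt) _.
by rewrite lee_fin powE spike_sorted_prob//; lra.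
Qed.
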